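(* Let $\mathbb{B}$ be a linearly ordered basis of a vector space $V$ over a field $\mathbb{F}$, let $p\in\mathbb{F}$ be a nonzero scalar, and let $\{f_E\mid E\in\mathcal{P}_{\mathrm{fin}}(\mathbb{B})\}$ be the basis of $\bigwedge V$ given by words in the alphabet $\mathbb{B}$ with strictly increasing order. Then the braided Hopf algebra $\Lambda_p(V)$ has the following structure maps. (Product) $\nabla(f_E\otimes f_F)=f_Ef_F=\delta_{|E\cap F|,0}\,(-1)^{\theta_{E,F}}f_{E\cup F}$ for all $E,F\in\mathcal{P}_{\mathrm{fin}}(\mathbb{B})$. (Coproduct) $\Delta f_E=\sum_{A\subseteq E}(-p)^{\theta_{A,E\setminus A}}f_A\otimes f_{E\setminus A}$ for all $E\in\mathcal{P}_{\mathrm{fin}}(\mathbb{B})$. (Antipode) $Sf_E=\gamma_{|E|}f_E$ for all $E\in\mathcal{P}_{\mathrm{fin}}(\mathbb{B})$, where $\gamma_k=(-1)^kp^{k(k-1)/2}$.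
   Context: $\mathcal{P}_{\mathrm{fin}}(\mathbb{B})$ is the set of finite subsets of $\mathbb{B}$. For $a,b\in\mathbb{B}$ set $\theta_{a,b}=1$ if $a>b$ and $\theta_{a,b}=0$ otherwise; for finite $A,B\subseteq\mathbb{B}$ set $\theta_{A,B}=\sum_{a\in A}\sum_{b\in B}\theta_{a,b}$. For $E=\{e_1<\dots<e_n\}$, $f_E=e_1e_2\cdots e_n\in\bigwedge V$, and $f_\emptyset=1$. Let $\tau\colon V\otimes V\to V\otimes V$ be the braiding given on basis elements by $\tau(a\otimes a)=-a\otimes a$; $\tau(a\otimes b)=-(1-p)a\otimes b-b\otimes a$ if $a>b$; $\tau(a\otimes b)=-p\,b\otimes a$ if $a<b$. It is invertible and satisfies the Yang--Baxter equation, and makes the tensor algebra $T(V)$ a braided Hopf algebra with all elements of $V$ primitive. $\Lambda_p(V)$ is the braided Hopf algebra $T(V)/\mathfrak{J}_2$, where $\mathfrak{J}_2$ is the Hopf ideal generated by $a^2$ ($a\in\mathbb{B}$) and $ab+ba$ ($a<b$ in $\mathbb{B}$). As an algebra it is the ordinary exterior algebra $\bigwedge V$ with product $\nabla$ and unit $1$. Its braiding $\hat\tau$ is the unique linear map on $\Lambda_p(V)^{\otimes2}$ with $\hat\tau|_{V\otimes V}=\tau$, $\hat\tau(1\otimes x)=x\otimes1$, $\hat\tau(x\otimes1)=1\otimes x$ and $\hat\tau(\nabla\otimes\nabla)=(\nabla\otimes\nabla)(\mathrm{id}\otimes\hat\tau\otimes\mathrm{id})(\hat\tau\otimes\hat\tau)(\mathrm{id}\otimes\hat\tau\otimes\mathrm{id})$.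 Its coproduct $\Delta$ is the unique linear map with $\Delta1=1\otimes1$, $\Delta v=v\otimes1+1\otimes v$ for $v\in V$, and $\Delta\nabla=(\nabla\otimes\nabla)(\mathrm{id}\otimes\hat\tau\otimes\mathrm{id})(\Delta\otimes\Delta)$. Its counit $\epsilon$ sends $1$ to $1$ and kills positive degrees, and its antipode $S$ satisfies $\nabla(\mathrm{id}\otimes S)\Delta=\eta\epsilon=\nabla(S\otimes\mathrm{id})\Delta$, where $\eta\colon\mathbb{F}\to\Lambda_p(V)$ is the unit map. *)

(* Defs.v *)
From HB Require Import structures.
From mathcomp Require Import all_boot all_order all_algebra.
From mathcomp Require Import ring_quotient finmap.
From mathcomp.classical Require Import boolp.
From mathcomp.multinomials Require Import monalg.

Set Implicit Arguments.
Unset Strict Implicit.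
Unset Printing Implicit Defensive.

Import Order.TTheory GRing.Theory.
Local Open Scope fset_scope.
Local Open Scope quotient_scope.
Local Open Scope ring_scope.

Section Span.
Variables (R : nzRingType) (M : lmodType R) (P : M -> Prop).

Definition in_span (x : M) : Prop :=
  exists2 s : seq (R * M), (forall u, u \in s -> P u.2)
    & x = \sum_(u <- s) u.1 *: u.2.

Definition span : {pred M} := fun x => `[< in_span x >].

Lemma spanP x : reflect (in_span x) (x \in span).
Proof. exact: asboolP. Qed.

Lemma span_gen x : P x -> x \in span.
Proof.
move=> Px; apply/spanP; exists [:: (1, x)]; last by rewrite big_seq1 scale1r.
by move=> u; rewrite inE => /eqP->.
Qed.

Lemma span_submod : submod_closed span.
Proof.
split; first by apply/spanP; exists [::]; rewrite ?big_nil.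
move=> a x y /spanP[s hs ->] /spanP[t ht ->]; apply/spanP.
exists ([seq (a * u.1, u.2) | u <- s] ++ t).
  by move=> u; rewrite mem_cat => /orP[/mapP[v /hs Pv ->]|/ht].
rewrite big_cat big_map scaler_sumr /=; congr (_ + _).
by apply: eq_bigr => u _; rewrite scalerA.
Qed.

HB.instance Definition _ := GRing.isSubmodClosed.Build R M span span_submod.

End Span.

(* Constructions are locked to keep unification from unfolding quotients. *)
Definition qmod (R : nzRingType) (M : lmodType R) (P : M -> Prop) : Type :=
  @Quotient.quot M (span P).
HB.instance Definition _ R M P := Choice.on (@qmod R M P).

HB.lock Definition qpi (R : nzRingType) (M : lmodType R) (P : M -> Prop)
  (x : M) : qmod P := \pi_(@Quotient.quot M (span P)) x.
HB.lock Definition qrepr (R : nzRingType) (M : lmodType R) (P : M -> Prop)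
  (x : qmod P) : M := repr (x : @Quotient.quot M (span P)).

HB.lock Definition qzero (R : nzRingType) (M : lmodType R) (P : M -> Prop) :
  qmod P := qpi P 0.
HB.lock Definition qopp (R : nzRingType) (M : lmodType R) (P : M -> Prop)
  (x : qmod P) : qmod P := qpi P (- qrepr x).
HB.lock Definition qadd (R : nzRingType) (M : lmodType R) (P : M -> Prop)
  (x y : qmod P) : qmod P := qpi P (qrepr x + qrepr y).
HB.lock Definition qscale (R : nzRingType) (M : lmodType R) (P : M -> Prop)
  (a : R) (x : qmod P) : qmod P := qpi P (a *: qrepr x).

Section Quotient.
Variables (R : nzRingType) (M : lmodType R) (P : M -> Prop).
Local Notation qmod := (qmod P).
Local Notation qpi := (qpi P).
Local Notation qrepr := (@qrepr R M P).

Lemma qreprK : cancel qrepr qpi.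
Proof. by rewrite qpi.unlock qrepr.unlock; exact: reprK. Qed.

Lemma qpi_eq x y : qpi x = qpi y <-> x - y \in span P.
Proof. by rewrite qpi.unlock Quotient.idealrBE; split=> /eqP. Qed.

Lemma qreprB (x : M) : qrepr (qpi x) - x \in span P.
Proof. by apply/qpi_eq; rewrite qreprK. Qed.

Lemma qoppE x : qopp (qpi x) = qpi (- x).
Proof. by rewrite qopp.unlock; apply/qpi_eq; rewrite -opprD rpredN qreprB. Qed.
Lemma qaddE x y : qadd (qpi x) (qpi y) = qpi (x + y).
Proof.
by rewrite qadd.unlock; apply/qpi_eq; rewrite opprD addrACA rpredD // qreprB.
Qed.
Lemma qscaleE a x : qscale a (qpi x) = qpi (a *: x).
Proof. by rewrite qscale.unlock; apply/qpi_eq; rewrite -scalerBr rpredZ // qreprB. Qed.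

Lemma qaddA : associative (@qadd R M P).
Proof.
by move=> x y z; rewrite -[x]qreprK -[y]qreprK -[z]qreprK !qaddE addrA.
Qed.
Lemma qaddC : commutative (@qadd R M P).
Proof. by move=> x y; rewrite -[x]qreprK -[y]qreprK !qaddE addrC. Qed.
Lemma qadd0 : left_id (qzero P) (@qadd R M P).
Proof. by move=> x; rewrite qzero.unlock -[x]qreprK qaddE add0r. Qed.
Lemma qaddN : left_inverse (qzero P) (@qopp R M P) (@qadd R M P).
Proof.
by move=> x; rewrite qzero.unlock -[x]qreprK qoppE qaddE addNr.
Qed.

HB.instance Definition _ := GRing.isZmodule.Build qmod qaddA qaddC qadd0 qaddN.

Lemma qpiD x y : qpi (x + y) = qpi x + qpi y.
Proof. exact/esym/qaddE. Qed.

Lemma qscaleA a b (x : qmod) : qscale a (qscale b x) = qscale (a * b) x.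
Proof. by rewrite -[x]qreprK !qscaleE scalerA. Qed.
Lemma qscale1 : left_id 1 (@qscale R M P).
Proof. by move=> x; rewrite -[x]qreprK qscaleE scale1r. Qed.
Lemma qscaleDr : right_distributive (@qscale R M P) +%R.
Proof.
by move=> a x y; rewrite -[x]qreprK -[y]qreprK -qpiD !qscaleE scalerDr qpiD.
Qed.
Lemma qscaleDl (x : qmod) : {morph (@qscale R M P)^~ x : a b / a + b}.
Proof. by move=> a b; rewrite -[x]qreprK !qscaleE scalerDl qpiD. Qed.

HB.instance Definition _ :=
  GRing.Zmodule_isLmodule.Build R qmod qscaleA qscale1 qscaleDr qscaleDl.

Lemma qpi_linear : linear qpi.
Proof. by move=> a x y; rewrite qpiD -qscaleE. Qed.
HB.instance Definition _ := GRing.isLinear.Build R M qmod *:%R qpi qpi_linear.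

Lemma qpi_rel x : P x -> qpi x = 0.
Proof.
move=> Px; rewrite -[RHS](raddf0 qpi); apply/qpi_eq.
by rewrite subr0 span_gen.
Qed.

Section Lift.
Variables (N : lmodType R) (f : {linear M -> N}).
Hypothesis fP : forall x, P x -> f x = 0.

Definition qlift (x : qmod) : N := f (qrepr x).

Lemma qliftE x : qlift (qpi x) = f x.
Proof.
apply/subr0_eq; rewrite /qlift -raddfB.
have /spanP[s hs ->] := qreprB x.
rewrite raddf_sum big_seq big1 // => u /hs /fP fu.
by rewrite /= linearZ_LR fu scaler0.
Qed.

Lemma qlift_linear : linear qlift.
Proof.
by move=> a x y; rewrite -[x]qreprK -[y]qreprK -linearP !qliftE linearP.
Qed.
End Lift.
End Quotient.

Section Ideal.
Variables (F : fieldType) (A : algType F).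

(* Two-sided multiples of relators: [span (mulrel P)] is the two-sided ideal
   generated by [P]. *)
Definition mulrel (P : A -> Prop) (x : A) : Prop :=
  exists a r b, P r /\ x = a * r * b.

(* [algType] excludes the zero ring, so relators are packaged with a proof
   that the ideal they generate is proper. *)
Record relators := Relators {
  relator :> A -> Prop;
  relator_proper : 1 \notin span (mulrel relator)
}.

End Ideal.

Definition qalg (F : fieldType) (A : algType F) (P : relators A) : Type :=
  qmod (mulrel P).
HB.instance Definition _ F A P := Choice.on (@qalg F A P).
HB.instance Definition _ F A P := GRing.Lmodule.on (@qalg F A P).

HB.lock Definition api (F : fieldType) (A : algType F) (P : relators A)
  (x : A) : qalg P := qpi (mulrel P) x.
HB.lock Definition arepr (F : fieldType) (A : algType F) (P : relators A)
  (x : qalg P) : A := qrepr x.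
HB.lock Definition qone (F : fieldType) (A : algType F) (P : relators A) :
  qalg P := api P 1.
HB.lock Definition qmul (F : fieldType) (A : algType F) (P : relators A)
  (x y : qalg P) : qalg P := api P (arepr x * arepr y).

Section QuotientAlgebra.
Variables (F : fieldType) (A : algType F) (P : relators A).
Local Notation I := (span (mulrel P)).
Local Notation qalg := (qalg P).
Local Notation api := (api P).
Local Notation arepr := (@arepr F A P).
Local Notation qone := (qone P).
Local Notation qmul := (@qmul F A P).

Lemma idealMl a x : x \in I -> a * x \in I.
Proof.
move=> /spanP[s hs ->]; rewrite mulr_sumr big_seq rpred_sum // => u /hs.
case=> [b [r [c [Pr ->]]]]; rewrite -scalerAr rpredZ //; apply: span_gen.
by exists (a * b), r, c; rewrite !mulrA.
Qed.

Lemma idealMr a x : x \in I -> x * a \in I.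
Proof.
move=> /spanP[s hs ->]; rewrite mulr_suml big_seq rpred_sum // => u /hs.
case=> [b [r [c [Pr ->]]]]; rewrite -scalerAl rpredZ //; apply: span_gen.
by exists b, r, (c * a); rewrite !mulrA.
Qed.

Lemma api_linear : linear api.
Proof. by rewrite api.unlock; exact: linearP. Qed.
HB.instance Definition _ := GRing.isLinear.Build F A qalg *:%R api api_linear.

Lemma areprK : cancel arepr api.
Proof. by rewrite api.unlock arepr.unlock; exact: qreprK. Qed.

Lemma api_eq x y : api x = api y <-> x - y \in I.
Proof. by rewrite api.unlock; exact: qpi_eq. Qed.

Lemma arepr_span x : arepr (api x) - x \in I.
Proof. by apply/api_eq; rewrite areprK. Qed.

Lemma qmulE x y : qmul (api x) (api y) = api (x * y).
Proof.
rewrite qmul.unlock; apply/api_eq; set x' := arepr _; set y' := arepr _.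
rewrite -(subrK (x' * y) (x' * y')) -addrA -mulrBr -mulrBl.
by apply: rpredD; [apply: idealMl|apply: idealMr]; exact: arepr_span.
Qed.

Lemma qoneE : qone = api 1.
Proof. by rewrite qone.unlock. Qed.

Lemma qmulA : associative qmul.
Proof.
by move=> x y z; rewrite -[x]areprK -[y]areprK -[z]areprK !qmulE mulrA.
Qed.
Lemma qmul1 : left_id qone qmul.
Proof. by move=> x; rewrite qone.unlock -[x]areprK qmulE mul1r. Qed.
Lemma qmulr1 : right_id qone qmul.
Proof. by move=> x; rewrite qone.unlock -[x]areprK qmulE mulr1. Qed.
Lemma qmulDl : left_distributive qmul +%R.
Proof.
move=> x y z; rewrite -[x]areprK -[y]areprK -[z]areprK -raddfD !qmulE.
by rewrite mulrDl raddfD.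
Qed.
Lemma qmulDr : right_distributive qmul +%R.
Proof.
move=> x y z; rewrite -[x]areprK -[y]areprK -[z]areprK -raddfD !qmulE.
by rewrite mulrDr raddfD.
Qed.
Lemma qone_neq0 : qone != 0.
Proof.
rewrite qone.unlock; apply/eqP; rewrite -(raddf0 api) => /api_eq; rewrite subr0.
by apply/negP; exact: relator_proper.
Qed.

HB.instance Definition _ := GRing.Zmodule_isNzRing.Build qalg
  qmulA qmul1 qmulr1 qmulDl qmulDr qone_neq0.

Lemma apiM x y : api (x * y) = api x * api y.
Proof. exact/esym/qmulE. Qed.

Lemma apiZ (a : F) (x : A) : api (a *: x) = a *: (api x : qalg).
Proof. exact: linearZ_LR. Qed.

Lemma qscaleAl (a : F) (x y : qalg) : a *: (x * y) = (a *: x) * y.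
Proof.
by rewrite -[x]areprK -[y]areprK -!(apiZ, apiM) -scalerAl.
Qed.
HB.instance Definition _ := GRing.Lmodule_isLalgebra.Build F qalg qscaleAl.

Lemma qscaleAr (a : F) (x y : qalg) : a *: (x * y) = x * (a *: y).
Proof.
by rewrite -[x]areprK -[y]areprK -!(apiZ, apiM) -scalerAr.
Qed.
HB.instance Definition _ := GRing.Lalgebra_isAlgebra.Build F qalg qscaleAr.

Lemma api_monoid : monoid_morphism api.
Proof. by split; [exact/esym/qoneE | exact: apiM]. Qed.
HB.instance Definition _ := GRing.isMonoidMorphism.Build A qalg api api_monoid.

Lemma api_rel x : P x -> api x = 0.
Proof.
move=> Px; rewrite api.unlock; apply: qpi_rel.
by exists 1, x, 1; rewrite mul1r mulr1.
Qed.
End QuotientAlgebra.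

(* An ideal killed by a multiplicative functional [e] is proper. *)
Lemma aug_ideal (F : fieldType) (A : algType F) (P : A -> Prop)
    (e : {scalar A}) : monoid_morphism e -> (forall x, P x -> e x = 0) ->
  forall x, x \in span (mulrel P) -> e x = 0.
Proof.
move=> [_ eM] eP x /spanP[s hs ->].
rewrite raddf_sum big_seq big1 // => u /hs[a [r [b [/eP er ->]]]].
by rewrite /= linearZ_LR /= !eM er mulr0 mul0r mulr0.
Qed.

Lemma aug_proper (F : fieldType) (A : algType F) (P : A -> Prop)
    (e : {scalar A}) : monoid_morphism e -> (forall x, P x -> e x = 0) ->
  1 \notin span (mulrel P).
Proof.
move=> eM eP; apply/negP => /(aug_ideal eM eP)/eqP.
by rewrite eM.1 oner_eq0.
Qed.

Section FreeModule.
Variables (F : fieldType) (X : choiceType) (N : lmodType F) (f : X -> N).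

Definition mext (x : {malg F[X]}) : N := \sum_(k <- msupp x) x@_k *: f k.

Lemma mextw (d : {fset X}) x :
  msupp x `<=` d -> mext x = \sum_(k <- d) x@_k *: f k.
Proof.
move=> sd; apply: big_fset_incl => // k _.
by rewrite -mcoeff_eq0 => /eqP->; rewrite scale0r.
Qed.

Lemma mext_linear : linear mext.
Proof.
move=> a x y; pose d := (msupp x `|` msupp y) `|` msupp (a *: x + y).
rewrite !(@mextw d); first 1 last.
- by rewrite /d fsubsetU // fsubsetUr.
- by rewrite /d fsubsetU // fsubsetUl.
- by rewrite /d fsubsetUr.
rewrite scaler_sumr -big_split; apply: eq_bigr => k _ /=.
by rewrite mcoeffD mcoeffZ scalerDl scalerA.
Qed.
HB.instance Definition _ := GRing.isLinear.Build F {malg F[X]} N *:%R mext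
  mext_linear.

Lemma mextU k : mext << k >> = f k.
Proof. by rewrite /mext msuppU oner_eq0 big_seq_fset1 mcoeffUU scale1r. Qed.
End FreeModule.

Section TensorProduct.
Variables (F : fieldType) (U W : lmodType F).

Inductive bilin_rel : {malg F[(U * W)%type]} -> Prop :=
| BilinL a u u' w :
    bilin_rel (<< (a *: u + u', w) >> - (a *: << (u, w) >> + << (u', w) >>))
| BilinR a u w w' :
    bilin_rel (<< (u, a *: w + w') >> - (a *: << (u, w) >> + << (u, w') >>)).

Definition tensor : Type := qmod bilin_rel.
HB.instance Definition _ := Choice.on tensor.
HB.instance Definition _ := GRing.Lmodule.on tensor.
End TensorProduct.

HB.lock Definition tens (F : fieldType) (U W : lmodType F) (u : U) (w : W) :
  tensor U W := qpi (@bilin_rel F U W) << (u, w) >>.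

(* The linear map on the tensor product induced by [f]; meaningful when [f] is
   bilinear. *)
HB.lock Definition tlift (F : fieldType) (U W N : lmodType F)
  (f : U -> W -> N) : tensor U W -> N := qlift (mext (fun k => f k.1 k.2)).

Section TensorTheory.
Variables (F : fieldType) (U W : lmodType F).
Local Notation tensor := (tensor U W).
Local Notation tens := (@tens F U W).

Lemma tens_linearl w : linear (tens^~ w).
Proof.
move=> a u u'; apply/subr0_eq; rewrite tens.unlock -linearP -raddfB.
exact/qpi_rel/BilinL.
Qed.

Lemma tens_linearr u : linear (tens u).
Proof.
move=> a w w'; apply/subr0_eq; rewrite tens.unlock -linearP -raddfB.
exact/qpi_rel/BilinR.
Qed.

Lemma tensDl w u u' : tens (u + u') w = tens u w + tens u' w.
Proof. by have := tens_linearl w 1 u u'; rewrite !scale1r. Qed.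
Lemma tens0l w : tens 0 w = 0.
Proof. by apply: (addIr (tens 0 w)); rewrite -tensDl !add0r. Qed.
Lemma tensZl w a u : tens (a *: u) w = a *: tens u w.
Proof. by have := tens_linearl w a u 0; rewrite tens0l !addr0. Qed.
Lemma tensDr u w w' : tens u (w + w') = tens u w + tens u w'.
Proof. by have := tens_linearr u 1 w w'; rewrite !scale1r. Qed.
Lemma tens0r u : tens u 0 = 0.
Proof. by apply: (addIr (tens u 0)); rewrite -tensDr !add0r. Qed.
Lemma tensZr u a w : tens u (a *: w) = a *: tens u w.
Proof. by have := tens_linearr u a w 0; rewrite tens0r !addr0. Qed.

Lemma tens_gen (t : tensor) : exists s : seq (U * W),
  t = \sum_(u <- s) tens u.1 u.2.
Proof.
rewrite -[t]qreprK [qrepr t]monalgE.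
exists [seq ((qrepr t)@_k *: k.1, k.2) | k <- msupp (qrepr t)].
rewrite big_map raddf_sum; apply: eq_bigr => -[u w] _ /=.
rewrite tensZl tens.unlock -linearZ_LR; congr (qpi _ _).
by apply/malgP => k; rewrite mcoeffZ !mcoeffU mulr_natr.
Qed.

Section TLift.
Variables (N : lmodType F) (f : U -> W -> N).
Hypotheses (fl : forall w, linear (f^~ w)) (fr : forall u, linear (f u)).

Lemma bilin_relP x : bilin_rel x -> mext (fun k : U * W => f k.1 k.2) x = 0.
Proof.
case=> [a u u' w|a u w w']; rewrite raddfB /= linearP /= !mextU /=.
  by rewrite fl subrr.
by rewrite fr subrr.
Qed.

Lemma tliftE u w : tlift f (tens u w) = f u w.
Proof.
rewrite tlift.unlock tens.unlock qliftE; first exact: mextU.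
exact: bilin_relP.
Qed.

Lemma tlift_linear : linear (tlift f).
Proof. rewrite tlift.unlock; exact/qlift_linear/bilin_relP. Qed.
End TLift.

Lemma tens_ext (N : lmodType F) (f g : {linear tensor -> N}) :
  (forall u w, f (tens u w) = g (tens u w)) -> f =1 g.
Proof.
move=> fg t; have [s ->] := tens_gen t.
by rewrite [LHS]raddf_sum [RHS]raddf_sum; apply: eq_bigr => u _; exact: fg.
Qed.
End TensorTheory.

Notation "x ⊗ y" := (tens x y) (at level 40, left associativity) : ring_scope.

HB.lock Definition tmap (F : fieldType) (U U' W W' : lmodType F)
  (f : {linear U -> U'}) (g : {linear W -> W'}) :
  tensor U W -> tensor U' W' := tlift (fun u w => f u ⊗ g w).

Section Map.
Variables (F : fieldType) (U U' W W' : lmodType F).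
Variables (f : {linear U -> U'}) (g : {linear W -> W'}).

Let fl w : linear (fun u => f u ⊗ g w).
Proof. by move=> a u u'; rewrite linearP tens_linearl. Qed.
Let fr u : linear (fun w => f u ⊗ g w).
Proof. by move=> a w w'; rewrite linearP tens_linearr. Qed.

Lemma tmap_linear : linear (tmap f g).
Proof. by rewrite tmap.unlock; exact: (tlift_linear fl fr). Qed.
HB.instance Definition _ := GRing.isLinear.Build F (tensor U W) (tensor U' W')
  *:%R (tmap f g) tmap_linear.

Lemma tmapE u w : tmap f g (u ⊗ w) = f u ⊗ g w.
Proof. by rewrite tmap.unlock; exact: (tliftE fl fr). Qed.
End Map.

(* [(u ⊗ v) ⊗ w |-> u ⊗ (v ⊗ w)] and its inverse *)
HB.lock Definition tassoc (F : fieldType) (U V W : lmodType F) :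
    tensor (tensor U V) W -> tensor U (tensor V W) :=
  tlift (fun t w => tlift (fun u v => u ⊗ (v ⊗ w)) t).
HB.lock Definition tassocV (F : fieldType) (U V W : lmodType F) :
    tensor U (tensor V W) -> tensor (tensor U V) W :=
  tlift (fun u t => tlift (fun v w => (u ⊗ v) ⊗ w) t).

Section Assoc.
Variables (F : fieldType) (U V W : lmodType F).

Let auxl (w : W) (t : tensor U V) : tensor U (tensor V W) :=
  tlift (fun u v => u ⊗ (v ⊗ w)) t.
Let auxr (u : U) (t : tensor V W) : tensor (tensor U V) W :=
  tlift (fun v w => (u ⊗ v) ⊗ w) t.

Let al w v : linear (fun u : U => u ⊗ ((v : V) ⊗ (w : W))).
Proof. exact: tens_linearl. Qed.
Let ar w u : linear (fun v : V => (u : U) ⊗ (v ⊗ (w : W))).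
Proof. by move=> a v v'; rewrite tens_linearl tens_linearr. Qed.
Let auxl_linear w : linear (auxl w).
Proof. exact: tlift_linear (al w) (ar w). Qed.
Let auxlE w u v : auxl w (u ⊗ v) = u ⊗ (v ⊗ w).
Proof. exact: (tliftE (al w) (ar w)). Qed.

Let auxl_linearr t : linear (fun w => auxl w t).
Proof.
move=> a w w'; have [s ->] := tens_gen t.
have auxS w0 : auxl w0 (\sum_(u <- s) u.1 ⊗ u.2)
    = \sum_(u <- s) u.1 ⊗ (u.2 ⊗ w0).
  pose aux0 : {linear _ -> _} := HB.pack (auxl w0)
    (GRing.isLinear.Build F _ _ *:%R (auxl w0) (auxl_linear w0)).
  rewrite -[LHS]/(aux0 _) raddf_sum.
  by apply: eq_bigr => u _; exact: auxlE.
rewrite !auxS scaler_sumr -big_split; apply: eq_bigr => u _ /=.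
by rewrite !tens_linearr.
Qed.

Lemma tassoc_linear : linear (@tassoc F U V W).
Proof. by rewrite tassoc.unlock; exact: tlift_linear auxl_linear auxl_linearr. Qed.
HB.instance Definition _ := GRing.isLinear.Build F _ _ *:%R (@tassoc F U V W)
  tassoc_linear.

Lemma tassocE (u : U) (v : V) (w : W) : tassoc ((u ⊗ v) ⊗ w) = u ⊗ (v ⊗ w).
Proof.
by rewrite tassoc.unlock (tliftE auxl_linear auxl_linearr); exact: auxlE.
Qed.

Let bl u w : linear (fun v : V => ((u : U) ⊗ v) ⊗ (w : W)).
Proof. by move=> a v v'; rewrite tens_linearr tens_linearl. Qed.
Let br u v : linear (fun w : W => ((u : U) ⊗ (v : V)) ⊗ w).
Proof. exact: tens_linearr. Qed.
Let auxr_linear u : linear (auxr u).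
Proof. exact: tlift_linear (bl u) (br u). Qed.
Let auxrE u v w : auxr u (v ⊗ w) = (u ⊗ v) ⊗ w.
Proof. exact: (tliftE (bl u) (br u)). Qed.

Let auxr_linearl t : linear (fun u => auxr u t).
Proof.
move=> a u u'; have [s ->] := tens_gen t.
have auxS u0 : auxr u0 (\sum_(v <- s) v.1 ⊗ v.2)
    = \sum_(v <- s) (u0 ⊗ v.1) ⊗ v.2.
  pose aux0 : {linear _ -> _} := HB.pack (auxr u0)
    (GRing.isLinear.Build F _ _ *:%R (auxr u0) (auxr_linear u0)).
  rewrite -[LHS]/(aux0 _) raddf_sum.
  by apply: eq_bigr => v _; exact: auxrE.
rewrite !auxS scaler_sumr -big_split; apply: eq_bigr => v _ /=.
by rewrite !tens_linearl.
Qed.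

Lemma tassocV_linear : linear (@tassocV F U V W).
Proof.
by rewrite tassocV.unlock; exact: tlift_linear auxr_linearl auxr_linear.
Qed.
HB.instance Definition _ := GRing.isLinear.Build F _ _ *:%R (@tassocV F U V W)
  tassocV_linear.

Lemma tassocVE (u : U) (v : V) (w : W) : tassocV (u ⊗ (v ⊗ w)) = (u ⊗ v) ⊗ w.
Proof.
by rewrite tassocV.unlock (tliftE auxr_linearl auxr_linear); exact: auxrE.
Qed.
End Assoc.

(* [id ⊗ f ⊗ id] on the fourth tensor power of [A], bracketed in pairs. *)
HB.lock Definition tmid (F : fieldType) (A : lmodType F)
    (f : {linear tensor A A -> tensor A A}) :
    tensor (tensor A A) (tensor A A) -> tensor (tensor A A) (tensor A A) :=
  @tassocV F A A (tensor A A)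
  \o tmap idfun (@tassoc F A A A \o tmap f idfun \o @tassocV F A A A)
  \o @tassoc F A A (tensor A A).

Section Mid.
Variables (F : fieldType) (A : lmodType F).
Variable f : {linear tensor A A -> tensor A A}.

Lemma tmid_linear : linear (tmid f).
Proof. by rewrite tmid.unlock; exact: linearP. Qed.
HB.instance Definition _ := GRing.isLinear.Build F _ _ *:%R (tmid f)
  tmid_linear.

Lemma tmidE u v v' w (s : seq (A * A)) : f (v ⊗ v') = \sum_(i <- s) i.1 ⊗ i.2 ->
  tmid f ((u ⊗ v) ⊗ (v' ⊗ w)) = \sum_(i <- s) (u ⊗ i.1) ⊗ (i.2 ⊗ w).
Proof.
move=> fvv; rewrite tmid.unlock /= tassocE tmapE /= tassocVE tmapE fvv /= {fvv}.
elim: s => [|i s IH]; first by rewrite !big_nil tens0l raddf0 tens0r raddf0.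
by rewrite !big_cons tensDl raddfD tensDr raddfD /= IH tassocE tassocVE.
Qed.
End Mid.

HB.lock Definition nabla (F : fieldType) (A : algType F) : tensor A A -> A :=
  tlift (fun x y => x * y).

Section Nabla.
Variables (F : fieldType) (A : algType F).

Let ml (y : A) : linear (fun x => x * y).
Proof. by move=> a x x'; rewrite mulrDl scalerAl. Qed.
Let mr (x : A) : linear (fun y => x * y).
Proof. by move=> a y y'; rewrite mulrDr scalerAr. Qed.

Lemma nabla_linear : linear (@nabla F A).
Proof. by rewrite nabla.unlock; exact: tlift_linear ml mr. Qed.
HB.instance Definition _ := GRing.isLinear.Build F _ _ *:%R (@nabla F A)
  nabla_linear.

Lemma nablaE (x y : A) : nabla (x ⊗ y) = x * y.
Proof. by rewrite nabla.unlock; exact: (tliftE ml mr). Qed.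
End Nabla.

Section FreeAlgebra.

Lemma malg_scaleAr (K : monomType) (R : comNzRingType) (a : R)
  (x y : {malg R[K]}) : a *: (x * y) = x * (a *: y).
Proof.
rewrite [RHS](@malgMEw _ _ (msupp x) (msupp y)) //; last first.
  apply/fsubsetP=> k; rewrite -!mcoeff_neq0 mcoeffZ.
  by apply: contraNneq => ->; rewrite mulr0.
rewrite malgME scaler_sumr; apply: eq_bigr => k _.
rewrite scaler_sumr; apply: eq_bigr => l _.
by apply/malgP => m; rewrite !mcoeffZ !mcoeffU mulrCA mulrnAr.
Qed.

Variables (F : fieldType) (V : choiceType).

(* An alias of [{malg F[{fmonom V}]}]: the [algType] structure attached to
   [malg] is reserved to commutative monomials. *)
Definition free_alg : Type := {malg F[{fmonom V}]}.
HB.instance Definition _ := GRing.Lalgebra.on free_alg.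

Lemma free_scaleAr (a : F) (x y : free_alg) : a *: (x * y) = x * (a *: y).
Proof. exact: malg_scaleAr. Qed.
HB.instance Definition _ :=
  GRing.Lalgebra_isAlgebra.Build F free_alg free_scaleAr.

Definition gen (v : V) : free_alg := << fmu v >>.

Definition free_aug (x : free_alg) : F := mcoeff (mone : {fmonom V}) x.

Lemma free_aug_scalar : scalar free_aug.
Proof. by move=> a x y; rewrite /free_aug mcoeffD mcoeffZ. Qed.
HB.instance Definition _ := GRing.isLinear.Build F free_alg F *%R free_aug
  free_aug_scalar.
Lemma free_augM : monoid_morphism free_aug.
Proof. by split; [exact: rmorph1 | exact: rmorphM]. Qed.
Lemma free_aug_gen v : free_aug (gen v) = 0.
Proof.
rewrite /free_aug mcoeffU1; case: eqP => // /(congr1 (@fdeg V)).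
by rewrite fdegU fdeg1.
Qed.
End FreeAlgebra.

Section TensorAlgebra.
Variables (F : fieldType) (V : lmodType F).
Local Notation gen := (@gen F V).

Inductive lin_rel : free_alg F V -> Prop :=
| LinRel a u v : lin_rel (gen (a *: u + v) - (a *: gen u + gen v)).

Lemma free_aug_lin x : lin_rel x -> free_aug x = 0.
Proof.
case=> a u v; rewrite raddfB /= free_aug_scalar !free_aug_gen.
by rewrite mulr0 addr0 subr0.
Qed.

Definition lin_proper := aug_proper (@free_augM F V) free_aug_lin.

(* [T(V)] as the free algebra on the set [V] modulo linearity of the
   generators; this needs no choice of a basis of [V]. *)
Definition tensor_alg : Type := qalg (Relators lin_proper).
HB.instance Definition _ := Choice.on tensor_alg.
HB.instance Definition _ := GRing.Algebra.on tensor_alg.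

Definition tin (v : V) : tensor_alg := api (Relators lin_proper) (gen v).

Lemma tin_linear : linear tin.
Proof.
move=> a u v; apply/subr0_eq; rewrite /tin -linearP -raddfB.
exact/api_rel/LinRel.
Qed.
HB.instance Definition _ := GRing.isLinear.Build F V tensor_alg *:%R tin
  tin_linear.

Definition tensor_aug (x : tensor_alg) : F := free_aug (arepr x).

Lemma tensor_augE x : tensor_aug (api (Relators lin_proper) x) = free_aug x.
Proof.
apply/subr0_eq; rewrite -raddfB.
exact/(aug_ideal (@free_augM F V) free_aug_lin)/arepr_span.
Qed.
Lemma tensor_aug_scalar : scalar tensor_aug.
Proof.
move=> a x y; rewrite -[x]areprK -[y]areprK -linearP !tensor_augE.
exact: linearP.
Qed.
HB.instance Definition _ := GRing.isLinear.Build F tensor_alg F *%R tensor_aug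
  tensor_aug_scalar.
Lemma tensor_augM : monoid_morphism tensor_aug.
Proof.
split.
  by rewrite -(api_monoid _).1 tensor_augE; exact: (@free_augM F V).1.
move=> x y; rewrite -[x]areprK -[y]areprK -apiM !tensor_augE.
exact: (@free_augM F V).2.
Qed.
Lemma tensor_aug_tin v : tensor_aug (tin v) = 0.
Proof. by rewrite tensor_augE free_aug_gen. Qed.
End TensorAlgebra.

Section Lambda.
Variables (F : fieldType) (V : lmodType F) (d : Order.disp_t) (B : orderType d).
Variable b : B -> V.

(* Linear independence forces [b] to be injective, so [b] identifies [B] with a
   linearly ordered subset of [V]. *)
Definition is_basis : Prop :=
  (forall v, exists s : seq B, exists c : B -> F,
     v = \sum_(a <- s) c a *: b a)
  /\ (forall (s : seq B) (c : B -> F), uniq s ->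
        \sum_(a <- s) c a *: b a = 0 -> {in s, forall a, c a = 0}).

Inductive ext_rel : tensor_alg V -> Prop :=
| ExtSquare a : ext_rel (tin (b a) * tin (b a))
| ExtAnti a c : (a < c)%O ->
    ext_rel (tin (b a) * tin (b c) + tin (b c) * tin (b a)).

Lemma tensor_aug_ext x : ext_rel x -> tensor_aug x = 0.
Proof.
have [_ eM] := @tensor_augM F V.
by case=> [a|a c _]; rewrite ?raddfD /= !eM !tensor_aug_tin mulr0 ?addr0.
Qed.

Definition ext_proper := aug_proper (@tensor_augM F V) tensor_aug_ext.

(* [T(V) / J_2]; it depends on neither [p] nor the braiding as an algebra. *)
Definition Lambda : Type := qalg (Relators ext_proper).
HB.instance Definition _ := Choice.on Lambda.
HB.instance Definition _ := GRing.Algebra.on Lambda.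

Definition lin (v : V) : Lambda := api (Relators ext_proper) (tin v).

Lemma lin_linear : linear lin.
Proof. by move=> a u v; rewrite /lin !linearP. Qed.
HB.instance Definition _ := GRing.isLinear.Build F V Lambda *:%R lin lin_linear.

Lemma lin_square a : lin (b a) * lin (b a) = 0.
Proof. by rewrite -apiM; exact/api_rel/ExtSquare. Qed.

Lemma lin_anti a c : (a < c)%O ->
  lin (b a) * lin (b c) + lin (b c) * lin (b a) = 0.
Proof.
move=> /ExtAnti r; have := @api_rel _ _ (Relators ext_proper) _ r.
by rewrite raddfD /= !apiM.
Qed.

Definition fword (E : {fset B}) : Lambda :=
  \prod_(a <- sort <=%O (enum_fset E)) lin (b a).

Definition theta (A C : {fset B}) : nat :=
  (\sum_(a <- A) \sum_(c <- C) (c < a)%O)%N.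

Record is_tau (p : F) (tau : tensor V V -> tensor V V) : Prop := IsTau {
  tau_eq a : tau (b a ⊗ b a) = - (b a ⊗ b a);
  tau_gt a c : (c < a)%O ->
    tau (b a ⊗ b c) = - (1 - p) *: (b a ⊗ b c) - b c ⊗ b a;
  tau_lt a c : (a < c)%O -> tau (b a ⊗ b c) = - p *: (b c ⊗ b a)
}.

Local Notation nab := (@nabla F Lambda).

(* The braided Hopf structure of [T(V) / J_2], through the equations that
   determine its braiding, coproduct, counit and antipode; the product [nab] and
   the unit are those of the algebra [Lambda]. Positive degrees are spanned by
   the nonempty products of vectors, whence [counit_pos]. *)
Record braided_Hopf (tau : {linear tensor V V -> tensor V V}) := BraidedHopf {
  braid : {linear tensor Lambda Lambda -> tensor Lambda Lambda};
  coprod : {linear Lambda -> tensor Lambda Lambda};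
  counit : {scalar Lambda};
  antipode : {linear Lambda -> Lambda};
  braidV t : braid (tmap lin lin t) = tmap lin lin (tau t);
  braid1l x : braid (1 ⊗ x) = x ⊗ 1;
  braid1r x : braid (x ⊗ 1) = 1 ⊗ x;
  braidM t : braid (tmap nab nab t)
    = tmap nab nab (tmid braid (tmap braid braid (tmid braid t)));
  coprod1 : coprod 1 = 1 ⊗ 1;
  coprodV v : coprod (lin v) = lin v ⊗ 1 + 1 ⊗ lin v;
  coprodM t : coprod (nab t)
    = tmap nab nab (tmid braid (tmap coprod coprod t));
  counit1 : counit 1 = 1;
  counit_pos (s : seq V) : s != [::] -> counit (\prod_(v <- s) lin v) = 0;
  antipodeR x : nabla (tmap idfun antipode (coprod x)) = counit x *: 1;
  antipodeL x : nabla (tmap antipode idfun (coprod x)) = counit x *: 1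
}.
End Lambda.

Definition gamma (F : fieldType) (p : F) (k : nat) : F :=
  (-1) ^+ k * p ^+ (k * (k - 1))./2.

(* Main.v *)
Require Import Defs.
From mathcomp Require Import all_boot all_order all_algebra.
From mathcomp Require Import finmap.
Import Order.TTheory GRing.Theory.
Local Open Scope fset_scope.
Local Open Scope ring_scope.

Set Implicit Arguments.
Unset Strict Implicit.
Unset Printing Implicit Defensive.

(* All three formulas follow by peeling off the smallest letter [e] of a word.
   Since [e] is smaller than every letter of [f_A], the braiding only involves
   the case [tau (e ⊗ a) = - p (a ⊗ e)], so it moves [e] past [f_A] with the
   scalar [(-p)^|A|]; hence each term [f_A ⊗ f_(E \ A)] of the coproduct of
   [f_E] yields the terms of [A] and [e |` A] in that of [f_(e |` E)].  For the
   antipode, [nabla (S ⊗ id) Delta f_E = 0] determines [S f_E] from smaller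
   words, and the required identity
   [\sum_(A <= E) p^theta(A, E \ A) gamma_|A| = 0] holds because the terms of
   [A] and [e |` A] cancel, as [gamma_(k+1) = - p^k gamma_k]. *)

(** * Least letters, [theta] and power sets over a linear order *)

Section MinInduction.
Variables (d : Order.disp_t) (B : orderType d).
Implicit Types (e a : B) (E A C : {fset B}).

Definition below e E := forall x, x \in E -> (e < x)%O.

Lemma below_notin e E : below e E -> e \notin E.
Proof. by move=> eE; apply/negP => /eE; rewrite ltxx. Qed.

Lemma belowW e E A : below e E -> A `<=` E -> below e A.
Proof. by move=> eE /fsubsetP AE x /AE/eE. Qed.

(** A finite set consists of the entries of its increasing enumeration, and the head of a strictly
    sorted list is below its tail, so list induction applies. *)
Lemma fset_min_ind (P : {fset B} -> Prop) :
  P fset0 -> (forall e E, below e E -> P E -> P (e |` E)) -> forall E, P E.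
Proof.
move=> P0 PU E.
have -> : E = [fset x in sort <=%O (enum_fset E)].
  by apply/fsetP => x; rewrite !inE mem_sort.
have: sorted <%O (sort <=%O (enum_fset E)) by rewrite sort_lt_sorted fset_uniq.
elim: (sort _ _) => [|e s IH] /=.
  move=> _; rewrite (_ : [fset _ in _] = fset0) //.
  by apply/fsetP => x; rewrite !inE.
rewrite lt_path_sortedE => /andP[/allP es /IH Ps]; rewrite fset_cons.
by apply: PU => // x; rewrite !inE => /es.
Qed.

Lemma sort_fsetU1 e E : below e E ->
  sort <=%O (enum_fset (e |` E)) = e :: sort <=%O (enum_fset E).
Proof.
move=> eE; apply: le_sorted_eq; first exact: sort_le_sorted.
  rewrite /= le_path_sortedE sort_le_sorted andbT.
  by apply/allP => x; rewrite mem_sort => /eE/ltW.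
apply: uniq_perm; rewrite /= ?sort_uniq ?fset_uniq //.
  by rewrite mem_sort below_notin // fset_uniq.
by move=> x; rewrite !(mem_sort, inE).
Qed.

Lemma thetaUl e A C : e \notin A ->
  theta (e |` A) C = (theta [fset e] C + theta A C)%N.
Proof. by move=> eA; rewrite /theta big_fsetU1 // big_seq_fset1. Qed.

Lemma thetaUr e A C : e \notin C ->
  theta A (e |` C) = (theta A [fset e] + theta A C)%N.
Proof.
move=> eC; rewrite /theta -big_split /=; apply: eq_bigr => a _.
by rewrite big_fsetU1 // big_seq_fset1.
Qed.

Lemma theta0l C : theta fset0 C = 0%N.
Proof. by rewrite /theta big_seq_fset0. Qed.

Lemma theta0r A : theta A fset0 = 0%N.
Proof. by rewrite /theta big1 // => a _; rewrite big_seq_fset0. Qed.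

Lemma theta_belowl e C : below e C -> theta [fset e] C = 0%N.
Proof.
move=> eC; rewrite /theta big_seq_fset1 big_seq big1 // => c /eC/ltW.
by rewrite leNgt => /negbTE->.
Qed.

Lemma theta_belowr e A : below e A -> theta A [fset e] = #|` A|.
Proof.
move=> eA; rewrite /theta (eq_big_seq (fun=> 1%N)); last first.
  by move=> a /eA ea; rewrite big_seq_fset1 ea.
by rewrite big_const_seq count_predT iter_addn_0 mul1n.
Qed.

(** Removing [e] matches the subsets containing [e] with the subsets of [E]; pairing each subset of
    [E] with its extension by [e] drives both the coproduct recursion and the cancellation for the
    antipode. *)
Lemma big_fpowersetU1 (R : Type) (idx : R) (op : Monoid.com_law idx) e E
    (f : {fset B} -> R) : e \notin E ->
  \big[op/idx]_(A <- fpowerset (e |` E)) f A =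
  \big[op/idx]_(A <- fpowerset E) op (f A) (f (e |` A)).
Proof.
move=> eE; rewrite big_split /=.
have -> : \big[op/idx]_(A <- fpowerset E) f (e |` A)
    = \big[op/idx]_(A <- [seq e |` A | A <- fpowerset E]) f A.
  by rewrite big_map.
rewrite -big_cat; apply: perm_big; apply: uniq_perm.
- exact: fset_uniq.
- rewrite cat_uniq fset_uniq /=; apply/andP; split.
    apply/hasPn => _ /mapP[A _ ->]; rewrite fpowersetE.
    by apply: contra eE => /fsubsetP; apply; rewrite !inE eqxx.
  rewrite map_inj_in_uniq ?fset_uniq // => A C.
  rewrite !fpowersetE => /fsubsetP AE /fsubsetP CE eq.
  have notin (D : {fset B}) : {subset D <= E} -> e \notin D.
    by move=> DE; apply: contra eE => /DE.
  by rewrite -(fsetU1K (notin _ AE)) eq fsetU1K // notin.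
move=> A; rewrite mem_cat !fpowersetE; apply/idP/orP.
  move=> AeE; have [eA|eA] := boolP (e \in A); [right|left].
    apply/mapP; exists (A `\ e); last by rewrite fsetD1K.
    by rewrite fpowersetE fsubDset.
  by rewrite -(mem_fsetD1 eA) fsubDset.
case=> [AE|/mapP[C]]; first by rewrite fsubsetU // AE orbT.
by rewrite fpowersetE => CE ->; rewrite fsetUS.
Qed.

Lemma fsetU1D e E A : e \notin A -> (e |` E) `\` A = e |` (E `\` A).
Proof.
move=> eA; apply/fsetP => x; rewrite !inE.
by case: eqVneq => [->|] //=; rewrite eA.
Qed.

Lemma fsetU1DU1 e E A : e \notin E -> (e |` E) `\` (e |` A) = E `\` A.
Proof.
move=> eE; apply/fsetP => x; rewrite !inE.
by case: eqVneq => [->|] //=; rewrite (negbTE eE) andbF.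
Qed.

End MinInduction.

Section TensorSums.
Variables (F : fieldType) (U W : lmodType F).

Lemma tens_sumr I (r : seq I) (P : pred I) (c : I -> F) (g : I -> W) (u : U) :
  u ⊗ (\sum_(i <- r | P i) c i *: g i)
  = \sum_(i <- r | P i) c i *: (u ⊗ g i).
Proof.
elim/big_rec2: _ => [|i y z _ <-]; first exact: tens0r.
by rewrite tensDr tensZr.
Qed.

End TensorSums.

(** * The product of increasing words *)

Section ExteriorWords.
Variables (F : fieldType) (V : lmodType F) (d : Order.disp_t) (B : orderType d).
Variable b : B -> V.
Implicit Types (e a : B) (E A C G : {fset B}).

Lemma fword0 : fword b fset0 = 1.
Proof. by rewrite /fword (_ : sort _ _ = [::]) ?big_nil. Qed.

Lemma fwordU1 e E : below e E -> fword b (e |` E) = lin b (b e) * fword b E.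
Proof. by move=> eE; rewrite /fword sort_fsetU1 // big_cons. Qed.

(** The letter [e] anticommutes past each smaller letter, is killed by an equal one, and stops in
    front of the first larger one. *)
Lemma lin_fword e E :
  lin b (b e) * fword b E
  = ((e \notin E)%:R * (-1) ^+ theta [fset e] E) *: fword b (e |` E).
Proof.
elim/fset_min_ind: E => [|h E hE IH].
  by rewrite theta_belowl ?mulr1 ?scale1r ?fwordU1 // => x; rewrite !inE.
have hnE := below_notin hE.
rewrite fwordU1 // mulrA thetaUr // in_fset1U.
have [->|neh] /= := eqVneq e h; first by rewrite lin_square !mul0r scale0r.
have [eh|he] := ltP e h; last first.
  have {}he : (h < e)%O by rewrite lt_neqAle eq_sym neh.
  have -> : lin b (b e) * lin b (b h) = - (lin b (b h) * lin b (b e)).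
    by apply/eqP; rewrite -addr_eq0 addrC lin_anti.
  have -> : theta [fset e] [fset h] = 1%N.
    by rewrite /theta !big_seq_fset1 he.
  rewrite mulNr -mulrA IH -scalerAr fsetUCA (@fwordU1 h); last first.
    by move=> x; rewrite !inE => /orP[/eqP->//|/hE].
  by rewrite exprS mulN1r mulrN scaleNr.
(* Now [e] is below the whole word: it is prepended without a sign, and [theta] vanishes. *)
have eE : below e (h |` E).
  by move=> x; rewrite !inE => /orP[/eqP->//|/hE]; exact: lt_trans.
have enE : e \notin E.
  by apply: contra (below_notin eE) => Ee; rewrite !inE Ee orbT.
rewrite enE (fwordU1 eE) fwordU1 // mulrA -[(_ + _)%N]thetaUr //.
by rewrite theta_belowl // mulr1 scale1r.
Qed.

Lemma fwordM E G :
  fword b E * fword b G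
  = ((#|` E `&` G| == 0%N)%:R * (-1) ^+ theta E G) *: fword b (E `|` G).
Proof.
elim/fset_min_ind: E => [|e E eE IH].
  by rewrite fword0 mul1r fset0I cardfs0 theta0l mulr1 scale1r fset0U.
have enE := below_notin eE.
rewrite fwordU1 // -mulrA IH -scalerAr lin_fword scalerA fsetUA.
have -> : (e |` E) `&` G = if e \in G then e |` (E `&` G) else E `&` G.
  apply/fsetP => x; case: ifP => eG; rewrite !inE; case: eqVneq => [->|] //=.
  by rewrite eG (negbTE enE).
have -> : (e \notin E `|` G) = (e \notin G) by rewrite inE (negbTE enE).
have [eG|eG] := boolP (e \in G) => /=.
  by rewrite !mul0r mulr0 cardfsU1 !inE (negbTE enE) /= mul0r.
(* All letters of [E] exceed [e], so only letters of [G] can be passed. *)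
have -> : theta [fset e] (E `|` G) = theta [fset e] G.
  rewrite /theta !big_seq_fset1; apply/esym.
  apply: big_fset_incl => [|c]; first exact: fsubsetUr.
  by rewrite inE => /orP[/eE/ltW|->//]; rewrite leNgt => /negbTE->.
by rewrite thetaUl // exprD mul1r; congr (_ *: _); rewrite mulrAC mulrA.
Qed.

End ExteriorWords.

(** * Middle braidings of pure tensors, and identities for [gamma] *)

Lemma tmid_scale (F : fieldType) (A : lmodType F)
    (f : {linear tensor A A -> tensor A A}) (c : F) (u v v' w x y : A) :
  f (v ⊗ v') = c *: (x ⊗ y) ->
  tmid f ((u ⊗ v) ⊗ (v' ⊗ w)) = c *: ((u ⊗ x) ⊗ (y ⊗ w)).
Proof.
move=> fE; rewrite (@tmidE _ _ _ _ _ _ _ [:: (c *: x, y)]).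
  by rewrite big_seq1 /= tensZr tensZl.
by rewrite big_seq1 /= tensZl.
Qed.

(** The exponent of [p] in [gamma p k] is the binomial coefficient ['C(k, 2)], which grows by [k] by
    Pascal's rule. *)
Lemma gammaS (F : fieldType) (p : F) k : gamma p k.+1 = - (p ^+ k * gamma p k).
Proof.
rewrite /gamma !subn1 -!bin2 binS bin1 exprD exprS.
by rewrite mulN1r mulNr mulrA mulrC.
Qed.

Lemma gamma_theta_sum (F : fieldType) (p : F) (d : Order.disp_t)
    (B : orderType d) (E : {fset B}) : E != fset0 ->
  \sum_(C <- fpowerset E) p ^+ theta C (E `\` C) * gamma p #|` C| = 0.
Proof.
elim/fset_min_ind: E => [|e E eE _ _]; first by rewrite eqxx.
have enE := below_notin eE.
rewrite big_fpowersetU1 // big_seq big1 // => C; rewrite fpowersetE => CE.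
have eC := belowW eE CE.
(* Put into the complement, [e] raises [theta] by the cardinality of [C]; put into [C], it adds
   nothing. [gammaS] then cancels the pair. *)
rewrite fsetU1D ?below_notin // fsetU1DU1 // thetaUl ?below_notin //.
have eD : below e (E `\` C) := belowW eE (fsubsetDl _ _).
rewrite thetaUr ?below_notin // theta_belowr // theta_belowl //.
by rewrite cardfsU1 below_notin // gammaS exprD mulrN -mulrA mulrCA /= subrr.
Qed.

(** * Braiding, coproduct and antipode on words *)

Section BraidedAlgebra.
Variables (F : fieldType) (A : algType F).
Variables (br : {linear tensor A A -> tensor A A}).
Local Notation nab := (@nabla F A).
Hypothesis br1l : forall x : A, br (1 ⊗ x) = x ⊗ 1.
Hypothesis brM : forall t, br (tmap nab nab t)
  = tmap nab nab (tmid br (tmap br br (tmid br t))).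

Lemma tmid1 (u x y : A) : tmid br ((u ⊗ 1) ⊗ (x ⊗ y)) = (u ⊗ x) ⊗ (1 ⊗ y).
Proof.
by rewrite (@tmid_scale _ _ _ 1 _ _ _ _ x 1) ?scale1r // br1l.
Qed.

(** Writing [u] as [1 * u] makes [brM] applicable: [u] crosses [x], then [y], while the auxiliary
    unit crosses both freely. *)
Lemma braid_scaleMr (c c' : F) (u x y : A) :
  br (u ⊗ x) = c *: (x ⊗ u) -> br (u ⊗ y) = c' *: (y ⊗ u) ->
  br (u ⊗ (x * y)) = (c * c') *: ((x * y) ⊗ u).
Proof.
move=> ux uy; have -> : u ⊗ (x * y) = tmap nab nab ((1 ⊗ u) ⊗ (x ⊗ y)).
  by rewrite tmapE /= !nablaE mul1r.
rewrite brM (tmid_scale _ _ ux) linearZ_LR /= tmapE br1l uy.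
rewrite tensZr !linearZ_LR /= tmid1 linearZ_LR /=.
by rewrite tmapE /= !nablaE mul1r scalerA mulrC.
Qed.

Variable cop : {linear A -> tensor A A}.
Hypothesis copM : forall t, cop (nab t)
  = tmap nab nab (tmid br (tmap cop cop t)).

(** The summand [v ⊗ 1] of [cop v] multiplies the left factors directly; [1 ⊗ v] must first cross
    [f i], which costs [q i]. *)
Lemma coprod_primM (v : A) (I : Type) (r : seq I) (P : pred I) (c q : I -> F)
    (f g : I -> A) (x : A) :
  cop v = v ⊗ 1 + 1 ⊗ v ->
  (forall i, P i -> br (v ⊗ f i) = q i *: (f i ⊗ v)) ->
  cop x = \sum_(i <- r | P i) c i *: (f i ⊗ g i) ->
  cop (v * x)
    = \sum_(i <- r | P i) (c i *: ((v * f i) ⊗ g i)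
                     + (c i * q i) *: (f i ⊗ (v * g i))).
Proof.
move=> dv vf dx; rewrite -nablaE copM tmapE /= dv dx.
rewrite tensDl !tens_sumr !raddfD !raddf_sum -big_split.
apply: eq_bigr => i Pi /=; rewrite !linearZ_LR /= ?linearZ_LR /=.
rewrite tmid1 tmapE /= !nablaE mul1r.
rewrite (tmid_scale _ _ (vf i Pi)) linearZ_LR /= tmapE /= !nablaE mul1r.
by rewrite scalerA.
Qed.

Section BasisWords.
Variables (d : Order.disp_t) (B : orderType d) (x : B -> A).
Variable f : {fset B} -> A.
Hypothesis f0 : f fset0 = 1.
Hypothesis fU1 : forall e E, below e E -> f (e |` E) = x e * f E.

Variable p : F.
Hypothesis br1r : forall y : A, br (y ⊗ 1) = 1 ⊗ y.
Hypothesis br_lt : forall a c, (a < c)%O ->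
  br (x a ⊗ x c) = - p *: (x c ⊗ x a).

Lemma braid_below e E : below e E ->
  br (x e ⊗ f E) = (- p) ^+ #|` E| *: (f E ⊗ x e).
Proof.
elim/fset_min_ind: E => [|h E hE IH] ehE; first by rewrite f0 br1r scale1r.
have ex : (e < h)%O by apply: ehE; rewrite !inE eqxx.
rewrite fU1 // cardfsU1 below_notin // exprS.
apply: braid_scaleMr; first exact: br_lt.
by apply: IH; apply: belowW ehE _; exact: fsubsetUr.
Qed.

Hypothesis cop1 : cop 1 = 1 ⊗ 1.
Hypothesis cop_x : forall e, cop (x e) = x e ⊗ 1 + 1 ⊗ x e.

Lemma coprod_word (E : {fset B}) : cop (f E)
  = \sum_(C <- fpowerset E) (- p) ^+ theta C (E `\` C) *: (f C ⊗ f (E `\` C)).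
Proof.
elim/fset_min_ind: E => [|e E eE IH].
  by rewrite fpowerset0 big_seq_fset1 fset0D theta0l scale1r f0 cop1.
have enE := below_notin eE.
(* [big_seq] records membership in the power set, so that [e] is known to be below each [C] when it
   is braided past [f C]. *)
rewrite big_fpowersetU1 // fU1 //; rewrite big_seq in IH.
have br_e C : C \in fpowerset E ->
    br (x e ⊗ f C) = (- p) ^+ #|` C| *: (f C ⊗ x e).
  by rewrite fpowersetE => /(belowW eE)/braid_below.
rewrite (coprod_primM (cop_x e) br_e IH).
rewrite [RHS]big_seq; apply: eq_bigr => C; rewrite fpowersetE => CE.
have eC := belowW eE CE.
have eD : below e (E `\` C) := belowW eE (fsubsetDl _ _).
rewrite fsetU1D ?below_notin // fsetU1DU1 // thetaUl ?below_notin //.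
rewrite thetaUr ?below_notin // theta_belowr // theta_belowl //.
by rewrite !fU1 // addrC exprD mulrC.
Qed.

Variables (eps : {scalar A}) (S : {linear A -> A}).
Hypothesis eps1 : eps 1 = 1.
Hypothesis eps_f : forall E, E != fset0 -> eps (f E) = 0.
Hypothesis fM : forall E C, E `&` C = fset0 ->
  f E * f C = (-1) ^+ theta E C *: f (E `|` C).
Hypothesis SL : forall y, nab (tmap S idfun (cop y)) = eps y *: 1.

Lemma antipode_word (E : {fset B}) : S (f E) = gamma p #|` E| *: f E.
Proof.
(* Strong induction on cardinality: the coproduct involves every proper subset of [E]. *)
have [n] := ubnP #|` E|; elim: n E => // n IH E; rewrite ltnS => En.
have [->|E0] := eqVneq E fset0.
  have := SL 1; rewrite cop1 tmapE /= nablaE mulr1 eps1 f0 => ->.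
  by rewrite /gamma mulr1.
have := SL (f E); rewrite (eps_f E0) (scale0r (1 : A)) coprod_word !raddf_sum /=.
(* All terms get the same closed form, plus a correction at [C = E], the only place where the
   unknown [S (f E)] occurs. *)
have term C : C \in fpowerset E ->
   nab (tmap S idfun ((- p) ^+ theta C (E `\` C) *: (f C ⊗ f (E `\` C))))
   = (p ^+ theta C (E `\` C) * gamma p #|` C|) *: f E
     + (C == E)%:R *: (S (f E) - gamma p #|` E| *: f E).
  rewrite fpowersetE => CE; rewrite 2!linearZ_LR /= tmapE /= nablaE.
  have [->|CnE] := eqVneq C E.
    by rewrite fsetDv theta0r f0 mulr1 !scale1r mul1r addrC subrK.
  rewrite scale0r addr0 IH; last first.
    by apply: leq_trans En; rewrite fproper_ltn_card // fproperEneq CnE.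
  rewrite -scalerAl fM; last first.
    by apply/fsetP => y; rewrite !inE; case: (y \in C).
  have -> : C `|` E `\` C = E by rewrite -[RHS](fsetID C E) (fsetIidPr CE).
  (* The sign from reordering the product turns the power of [- p] into one of [p]. *)
  by rewrite !scalerA mulrAC -exprMn mulrN1 opprK.
(* The uniform part sums to zero, so the correction at [E] must vanish. *)
rewrite (eq_big_seq _ term) big_split /= -scaler_suml gamma_theta_sum //.
rewrite scale0r add0r.
rewrite (big_fsetD1 E) ?fpowersetE //= eqxx scale1r.
rewrite big_seq big1 ?addr0 => [/eqP|C]; first by rewrite subr_eq0 => /eqP.
by rewrite !inE => /andP[/negbTE-> _]; rewrite scale0r.
Qed.

End BasisWords.
End BraidedAlgebra.

Theorem theorem2 (F : fieldType) (V : lmodType F)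
    (d : Order.disp_t) (B : orderType d) (b : B -> V) (hb : is_basis b)
    (p : F) (hp : p != 0)
    (tau : {linear tensor V V -> tensor V V}) (htau : is_tau b p tau)
    (H : braided_Hopf b tau) :
  [/\ forall E G : {fset B},
        nabla (fword b E ⊗ fword b G) = fword b E * fword b G /\
        fword b E * fword b G
          = ((#|` E `&` G| == 0%N)%:R * (-1) ^+ theta E G) *: fword b (E `|` G),
      forall E : {fset B},
        coprod H (fword b E)
          = \sum_(A <- fpowerset E)
              (- p) ^+ theta A (E `\` A) *: (fword b A ⊗ fword b (E `\` A))
    & forall E : {fset B},
        antipode H (fword b E) = gamma p #|` E| *: fword b E].
Proof.
have br_lt a c : (a < c)%O -> braid H (lin b (b a) ⊗ lin b (b c))
    = - p *: (lin b (b c) ⊗ lin b (b a)).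
  move=> ac; have := braidV H (b a ⊗ b c).
  by rewrite (tau_lt htau ac) linearZ_LR /= !tmapE.
have coprod_fword := coprod_word
  (@braid1l _ _ _ _ _ _ H) (@braidM _ _ _ _ _ _ H) (@coprodM _ _ _ _ _ _ H)
  (fword0 b) (@fwordU1 _ _ _ _ b)
  (@braid1r _ _ _ _ _ _ H) br_lt (@coprod1 _ _ _ _ _ _ H)
  (fun e => @coprodV _ _ _ _ _ _ H (b e)).
split=> //.
  by move=> E G; split; [exact: nablaE | exact: fwordM].
have eps_f E : E != fset0 -> counit H (fword b E) = 0.
  (* A nonempty word is a product over a nonempty list of vectors, to which [counit_pos] applies. *)
  move=> E0; pose s := [seq b a | a <- sort <=%O (enum_fset E)].
  rewrite -(counit_pos H (s := s)); first by rewrite big_map.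
  by rewrite -size_eq0 size_map size_sort cardfs_eq0.
have fM (E C : {fset B}) : E `&` C = fset0 ->
    fword b E * fword b C = (-1) ^+ theta E C *: fword b (E `|` C).
  by move=> EC; rewrite fwordM EC cardfs0 mul1r.
exact: (antipode_word (@braid1l _ _ _ _ _ _ H) (@braidM _ _ _ _ _ _ H)
  (@coprodM _ _ _ _ _ _ H) (fword0 b) (@fwordU1 _ _ _ _ b)
  (@braid1r _ _ _ _ _ _ H) br_lt (@coprod1 _ _ _ _ _ _ H)
  (fun e => @coprodV _ _ _ _ _ _ H (b e)) (counit1 H) eps_f fM
  (@antipodeL _ _ _ _ _ _ H)).
Qed.
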